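(* Let $\lambda\vdash n$ (with $n\ge2$) be a hook shape and let $\tilde\lambda=(a,b)$ be the composition of $n-1$ in which $a$ is the arm length and $b$ is the leg length of $\lambda$. Then the $S_{n-1}$-representation $(\eta,S^\lambda_{\mathsf{Sch}})$ is isomorphic to the permutation module $M^{\tilde\lambda}$.
   Context: All representations are over $\mathbb{C}$. A hook shape is a partition $\lambda=(m,1,\dots,1)$. Its arm consists of the boxes of the first row excluding the first box, and its leg of the boxes of the first column excluding the first box; so for $\lambda=(m,1^b)$ one has $\tilde\lambda=(m-1,b)$. Parts equal to zero are allowed in compositions. For a composition $\mu$ of $r$, $M^\mu=\mathrm{Ind}_{S_\mu}^{S_r}(\mathbb{C})$ is the module induced from the trivial representation of the parabolic (Young) subgroup $S_\mu\subseteq S_r$. It has a basis given by the $\mu$-tabloids (row-equivalence classes of bijective fillings of the diagram of $\mu$ by $1,\dots,r$), permuted by $S_r$ acting on entries. $\mathrm{SYT}(\lambda)$ is the set of standard Young tableaux of shape $\lambda$ with entries $1,\dots,n$. The vector space underlying $S^\lambda_{\mathsf{Sch}}$ is the Specht module $S^\lambda$ with its Kazhdan–Lusztig basis $\{b_T : T\in\mathrm{SYT}(\lambda)\}$ (a basis indexed by standard tableaux). For $1\le k\le n-1$ let $t_k$ act on $\mathrm{SYT}(\lambda)$ by swapping the entries $k$ and $k+1$ of $T$ if the boxes containing them are not adjacent (horizontally or vertically), and by $t_k\cdot T=T$ otherwise. Let $\psi(t_k)\in GL(S^\lambda_{\mathsf{Sch}})$ be given by $\psi(t_k)b_T=b_{t_k\cdot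 T}$. For a hook shape $\lambda$, $\eta:S_{n-1}\to GL(S^\lambda_{\mathsf{Sch}})$ is the (well-defined) group homomorphism with $\eta(s_k)=\psi(t_{k+1})$ for $1\le k\le n-2$, where $s_k\in S_{n-1}$ is the transposition swapping $k$ and $k+1$. *)

(* Defs.v *)
From HB Require Import structures.
From mathcomp Require Import all_boot all_order all_algebra all_fingroup.
From mathcomp Require Import reals complex zify.

Set Implicit Arguments.
Unset Strict Implicit.
Unset Printing Implicit Defensive.

Import GRing.Theory GroupScope.
Local Open Scope ring_scope.

(* Conventions.
   - Entries 1, ..., r are represented by 'I_r: the ordinal i stands for the
     entry i + 1.  Rows and columns are numbered from 0.
   - In MathComp the product g * h of permutations is "g, then h", i.e. the
     composite usually written h o g. Hence a homomorphism rho : S_r -> GL(V)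
     for the usual (right-to-left) composition reads
     rho (g * h) = rho h \o rho g. *)

Definition is_partition (n : nat) (lam : seq nat) : bool :=
  [&& sorted geq lam, 0%N \notin lam & sumn lam == n].

Record partition_of (n : nat) :=
  PartitionOf { parts :> seq nat; partsP : is_partition n parts }.

Definition is_hook (lam : seq nat) : Prop :=
  exists m b : nat, lam = m :: nseq b 1%N.

Definition arm (lam : seq nat) : nat := (nth 0%N lam 0).-1.
Definition leg (lam : seq nat) : nat := (size lam).-1.

(* The boxes of the diagram of a composition (zero parts allowed). *)
Definition box (mu : seq nat) : Type :=
  {i : 'I_(size mu) & 'I_(nth 0%N mu i)}.
HB.instance Definition _ (mu : seq nat) := Finite.on (box mu).

Definition row (mu : seq nat) (x : box mu) : nat := tag x.
Definition col (mu : seq nat) (x : box mu) : nat := tagged x.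

Definition adjacent (mu : seq nat) (x y : box mu) : bool :=
     (row x == row y) && ((col y == (col x).+1) || (col x == (col y).+1))
  || (col x == col y) && ((row y == (row x).+1) || (row x == (row y).+1)).

Definition bijective_filling (mu : seq nat) (r : nat)
    (F : {ffun box mu -> 'I_r}) : bool :=
  injectiveb F && [forall k, k \in codom F].

Definition filling (mu : seq nat) (r : nat) : Type :=
  {F : {ffun box mu -> 'I_r} | bijective_filling F}.
HB.instance Definition _ (mu : seq nat) (r : nat) := Finite.on (filling mu r).
HB.instance Definition _ (mu : seq nat) (r : nat) := SubType.on (filling mu r).

Definition box_entry (mu : seq nat) (r : nat) (F : filling mu r) (x : box mu) :
  'I_r := val F x.

Definition standard (mu : seq nat) (r : nat) (F : filling mu r) : bool :=
  [forall x, forall y,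
     ((row x == row y) && (col x < col y)%N
      || (col x == col y) && (row x < row y)%N)
     ==> (box_entry F x < box_entry F y)%N].

Definition syt (n : nat) (lam : partition_of n) : Type :=
  {F : filling lam n | standard F}.
HB.instance Definition _ (n : nat) (lam : partition_of n) :=
  Finite.on (syt lam).
HB.instance Definition _ (n : nat) (lam : partition_of n) :=
  SubType.on (syt lam).

(* The transposition of S_r swapping the entries k and k + 1 (counted from 1),
   for 1 <= k <= r - 1; it is 1 for the other values of k. *)
Definition simple_transp (r k : nat) : 'S_r :=
  match insub k.-1, insub k with
  | Some i, Some j => tperm i j
  | _, _ => 1%g
  end.

Fact permute_filling_subproof (mu : seq nat) (r : nat) (s : 'S_r)
    (F : filling mu r) :
  bijective_filling [ffun x => s (box_entry F x)].
Proof.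
have /andP[/injectiveP Finj /forallP Fsurj] := valP F.
apply/andP; split.
  by apply/injectiveP => x y; rewrite !ffunE => /perm_inj /Finj.
apply/forallP => k; have /codomP[x kE] := Fsurj (s^-1 k)%g.
by apply/codomP; exists x; rewrite ffunE /box_entry -kE permKV.
Qed.

Definition permute_filling (mu : seq nat) (r : nat) (s : 'S_r)
    (F : filling mu r) : filling mu r :=
  Sub [ffun x => s (box_entry F x)] (permute_filling_subproof s F).

Lemma permute_fillingE (mu : seq nat) (r : nat) (s : 'S_r) (F : filling mu r)
    (x : box mu) :
  box_entry (permute_filling s F) x = s (box_entry F x).
Proof. by rewrite /box_entry /= ffunE. Qed.

(* The entries k and k + 1 (counted from 1) lie in adjacent boxes. *)
Definition adjacent_entries (mu : seq nat) (r : nat) (k : nat)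
    (F : filling mu r) : bool :=
  [exists x, exists y, [&& (box_entry F x).+1 == k,
                           (box_entry F y).+1 == k.+1 & adjacent x y]].

Definition t_filling (mu : seq nat) (r : nat) (k : nat) (F : filling mu r) :
    filling mu r :=
  if adjacent_entries k F then F else permute_filling (simple_transp r k) F.

Lemma simple_transp_mono (r k : nat) (i j : 'I_r) :
  (i < j)%N -> ~~ ((i.+1 == k) && (j.+1 == k.+1)) ->
  (simple_transp r k i < simple_transp r k j)%N.
Proof.
move=> ltij nk; rewrite /simple_transp.
case: insubP => [a _ aE|_]; last by rewrite !perm1.
case: insubP => [c _ cE|_]; last by rewrite !perm1.
rewrite /= in aE cE.
have E (x : 'I_r) : (tperm a c x : nat) =
    if x == k.-1 :> nat then k else if x == k :> nat then k.-1 else x.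
  case: tpermP => [->|->|/eqP nia /eqP nic].
  - by rewrite aE cE eqxx.
  - by rewrite aE cE eqxx; case: eqP.
  - by rewrite -!val_eqE /= aE cE in nia nic; rewrite (negbTE nia) (negbTE nic).
rewrite !E; move: nk; do ![case: eqP => //=]; lia.
Qed.

Lemma standard_adjacent (n : nat) (lam : partition_of n) (F : filling lam n)
    (x y : box lam) :
  standard F ->
  (row x == row y) && (col x < col y)%N
    || (col x == col y) && (row x < row y)%N ->
  (box_entry F y = (box_entry F x).+1 :> nat) -> adjacent x y.
Proof.
move=> /forallP stdF; rewrite /adjacent => xy Fxy.
have lt2 (z : box lam) : (row x == row z) && (col x < col z)%N
    || (col x == col z) && (row x < row z)%N ->
    (row z == row y) && (col z < col y)%N
    || (col z == col y) && (row z < row y)%N -> False.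
  move=> xz zy; have /forallP/(_ z)/implyP/(_ xz) := stdF x.
  by have /forallP/(_ y)/implyP/(_ zy) := stdF z; lia.
case/orP: (xy) => /andP[/eqP e l].
  have [far|near] := ltnP (col x).+1 (col y); last by lia.
  have hz : ((col x).+1 < nth 0%N lam (tag x))%N.
    rewrite [X in nth _ _ X]e; exact: ltn_trans far (ltn_ord _).
  pose z : box lam := Tagged (fun i : 'I_(size lam) => 'I_(nth 0%N lam i)) (Ordinal hz).
  have rz : row z = row x by [].
  have cz : col z = (col x).+1 by [].
  by case: (lt2 z); rewrite rz cz; lia.
have [far|near] := ltnP (row x).+1 (row y); last by lia.
have hr : ((row x).+1 < size lam)%N by exact: ltn_trans far (ltn_ord (tag y)).
have hz : (col x < nth 0%N lam (Ordinal hr))%N.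
  rewrite e; apply: leq_trans (ltn_ord (tagged y)) _ => /=.
  have /and3P[srt _ _] := partsP lam.
  apply: (sorted_leq_nth _ _ 0%N srt) => //.
  - by move=> u v w; rewrite /geq /=; lia.
  - by move=> u; rewrite /geq /=.
  - by rewrite inE ltn_ord.
pose z : box lam := Tagged (fun i : 'I_(size lam) => 'I_(nth 0%N lam i)) (Ordinal hz).
have rz : row z = (row x).+1 by [].
have cz : col z = col x by [].
by case: (lt2 z); rewrite rz cz; lia.
Qed.

Fact t_syt_subproof (n : nat) (lam : partition_of n) (k : nat) (T : syt lam) :
  standard (t_filling k (val T)).
Proof.
have stdT := valP T; rewrite /t_filling; case: ifPn => // nadj.
have /forallP std := stdT.
apply/forallP => x; apply/forallP => y; apply/implyP => xy.
rewrite !permute_fillingE; apply: simple_transp_mono.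
  by have /forallP/(_ y)/implyP/(_ xy) := std x.
apply: contra nadj => /andP[xk yk].
apply/existsP; exists x; apply/existsP; exists y; rewrite xk yk /=.
by apply: (standard_adjacent stdT xy); lia.
Qed.

Definition t_syt (n : nat) (lam : partition_of n) (k : nat) (T : syt lam) :
  syt lam := Sub (t_filling k (val T)) (t_syt_subproof k T).

(* A representation of H <= S_r on V; only the values of srepr_fun on H matter.
   The matrix representations of mxrepresentation would force a choice of bases
   on Specht and induced modules. *)
Record srepr (K : fieldType) (r : nat) (H : {group 'S_r}) (V : vectType K) :=
  SRepr {
    srepr_fun :> 'S_r -> 'End(V);
    srepr1 : srepr_fun 1%g = \1%VF;
    sreprM : forall g h, g \in H -> h \in H ->
      srepr_fun (g * h)%g = (srepr_fun h \o srepr_fun g)%VF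
  }.

Definition srepr_iso (K : fieldType) (r : nat) (H : {group 'S_r})
    (V W : vectType K) (rho : srepr H V) (sigma : srepr H W) : Prop :=
  exists f : 'Hom(V, W),
    [/\ lker f = 0%VS, limg f = fullv
      & forall g, g \in H -> forall v, f (rho g v) = sigma g (f v)].

Definition srepr_triv (K : fieldType) (r : nat) (H : {group 'S_r}) :
  srepr H K^o.
Proof.
by apply: (@SRepr K r H K^o (fun=> \1%VF)) => // g h _ _; rewrite comp_lfun1l.
Defined.

(* Ind_H^{S_r} W is realised as the space of all f : S_r -> W such that
   f (g o h) = rho(h)^-1 (f g) for g in S_r and h in H, on which x acts by
   (x . f) g = f (x^-1 o g). *)
Definition ind_defect (K : fieldType) (r : nat) (H : {group 'S_r})
    (W : vectType K) (rho : srepr H W) (h : 'S_r) (f : {ffun 'S_r -> W}) :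
  {ffun 'S_r -> W} := [ffun g => f (h * g)%g - rho h^-1%g (f g)].

Fact ind_defect_is_linear (K : fieldType) (r : nat) (H : {group 'S_r})
    (W : vectType K) (rho : srepr H W) (h : 'S_r) : linear (ind_defect rho h).
Proof.
move=> a f f'; apply/ffunP => g; rewrite !ffunE linearP scalerBr opprD.
by rewrite addrACA.
Qed.
HB.instance Definition _ (K : fieldType) (r : nat) (H : {group 'S_r})
    (W : vectType K) (rho : srepr H W) (h : 'S_r) :=
  GRing.isLinear.Build K {ffun 'S_r -> W} {ffun 'S_r -> W} *:%R
    (ind_defect rho h) (ind_defect_is_linear rho h).

Definition ind_space (K : fieldType) (r : nat) (H : {group 'S_r})
    (W : vectType K) (rho : srepr H W) : {vspace {ffun 'S_r -> W}} :=
  (\bigcap_(h in H) lker (linfun (ind_defect rho h)))%VS.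

Lemma ind_spaceP (K : fieldType) (r : nat) (H : {group 'S_r})
    (W : vectType K) (rho : srepr H W) (f : {ffun 'S_r -> W}) :
  reflect (forall g h, h \in H -> f (h * g)%g = rho h^-1%g (f g))
          (f \in ind_space rho).
Proof.
rewrite /ind_space memvE.
apply: (iffP (@subv_bigcapP _ _ _ _ _ _)) => [fH g h hH | fH h hH].
  have := fH h hH; rewrite -memvE memv_ker lfunE /= => /eqP/ffunP/(_ g).
  by rewrite !ffunE => /eqP; rewrite subr_eq0 => /eqP.
rewrite -memvE memv_ker lfunE /=; apply/eqP/ffunP => g.
by rewrite !ffunE fH // subrr.
Qed.

Definition ind_act (K : fieldType) (r : nat) (W : vectType K) (x : 'S_r)
    (f : {ffun 'S_r -> W}) : {ffun 'S_r -> W} := [ffun g => f (g * x^-1)%g].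

Lemma ind_act_stable (K : fieldType) (r : nat) (H : {group 'S_r})
    (W : vectType K) (rho : srepr H W) (x : 'S_r) (f : {ffun 'S_r -> W}) :
  f \in ind_space rho -> ind_act x f \in ind_space rho.
Proof.
move=> /ind_spaceP fH; apply/ind_spaceP => g h hH.
by rewrite !ffunE -mulgA fH.
Qed.

Definition ind_sub_act (K : fieldType) (r : nat) (H : {group 'S_r})
    (W : vectType K) (rho : srepr H W) (x : 'S_r)
    (u : subvs_of (ind_space rho)) : subvs_of (ind_space rho) :=
  Subvs (ind_act_stable x (subvsP u)).

Fact ind_sub_act_is_linear (K : fieldType) (r : nat) (H : {group 'S_r})
    (W : vectType K) (rho : srepr H W) (x : 'S_r) :
  linear (@ind_sub_act K r H W rho x).
Proof. by move=> a u v; apply/val_inj/ffunP => g; rewrite /= !ffunE. Qed.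
HB.instance Definition _ (K : fieldType) (r : nat) (H : {group 'S_r})
    (W : vectType K) (rho : srepr H W) (x : 'S_r) :=
  GRing.isLinear.Build K (subvs_of (ind_space rho)) (subvs_of (ind_space rho))
    *:%R (@ind_sub_act K r H W rho x) (@ind_sub_act_is_linear K r H W rho x).

Fact ind_act1 (K : fieldType) (r : nat) (H : {group 'S_r})
    (W : vectType K) (rho : srepr H W) :
  linfun (@ind_sub_act K r H W rho 1%g) = \1%VF.
Proof.
apply/lfunP => u; rewrite !lfunE /=; apply/val_inj/ffunP => g.
by rewrite /= !ffunE invg1 mulg1.
Qed.

Fact ind_actM (K : fieldType) (r : nat) (H : {group 'S_r})
    (W : vectType K) (rho : srepr H W) (x y : 'S_r) :
  linfun (@ind_sub_act K r H W rho (x * y)%g) =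
  (linfun (@ind_sub_act K r H W rho y) \o linfun (@ind_sub_act K r H W rho x))%VF.
Proof.
apply/lfunP => u; rewrite comp_lfunE !lfunE /=; apply/val_inj/ffunP => g.
by rewrite /= !ffunE invMg mulgA.
Qed.

Definition induced (K : fieldType) (r : nat) (H : {group 'S_r})
    (W : vectType K) (rho : srepr H W) :
  srepr [set: 'S_r]%G (subvs_of (ind_space rho)) :=
  @SRepr K r [set: 'S_r]%G (subvs_of (ind_space rho))
    (fun x => linfun (@ind_sub_act K r H W rho x))
    (ind_act1 rho) (fun x y _ _ => ind_actM rho x y).

(* reshape_index mu i is the index of the block containing i when 0, 1, 2, ...
   is cut into consecutive blocks of lengths mu_0, mu_1, ... *)
Definition young_set (r : nat) (mu : seq nat) : {set 'S_r} :=
  [set s : 'S_r | [forall i : 'I_r, reshape_index mu (s i) == reshape_index mu i]].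

Fact young_group_set (r : nat) (mu : seq nat) : group_set (young_set r mu).
Proof.
apply/group_setP; split=> [|s t]; first by rewrite inE; apply/forallP => i; rewrite perm1.
rewrite !inE => /forallP sY /forallP tY; apply/forallP => i.
by rewrite permM (eqP (tY _)) sY.
Qed.
Canonical young_group (r : nat) (mu : seq nat) : {group 'S_r} :=
  Group (young_group_set r mu).

Definition perm_module (K : fieldType) (r : nat) (mu : seq nat) :=
  induced (srepr_triv K (young_group r mu)).

(* Fillings are bijective, so F and G are row-equivalent when each entry lies in
   the same row of both. *)
Definition row_equiv (mu : seq nat) (r : nat) : rel (filling mu r) :=
  [rel F G | [forall x, forall y,
                (box_entry F x == box_entry G y) ==> (row x == row y)]].

(* A tabloid is literally a row-equivalence class of fillings. *)
Definition tabloid (mu : seq nat) (r : nat) : Type :=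
  {A : {set filling mu r} |
     A \in equivalence_partition (@row_equiv mu r) [set: filling mu r]}.
HB.instance Definition _ (mu : seq nat) (r : nat) := Finite.on (tabloid mu r).
HB.instance Definition _ (mu : seq nat) (r : nat) := SubType.on (tabloid mu r).

Fact tabloid_of_subproof (mu : seq nat) (r : nat) (F : filling mu r) :
  [set G in [set: filling mu r] | row_equiv F G]
    \in equivalence_partition (@row_equiv mu r) [set: filling mu r].
Proof. by apply/imsetP; exists F. Qed.

Definition tabloid_of (mu : seq nat) (r : nat) (F : filling mu r) :
  tabloid mu r := @Sub _ _ (tabloid mu r) _ (tabloid_of_subproof F).

Definition tabloid_vect (K : fieldType) (mu : seq nat) (r : nat)
    (A : tabloid mu r) : {ffun tabloid mu r -> K^o} :=
  [ffun B => (B == A)%:R].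

Definition col_stab (mu : seq nat) (r : nat) (F : filling mu r) : {set 'S_r} :=
  [set s : 'S_r | [forall x, forall y,
              (s (box_entry F x) == box_entry F y) ==> (col x == col y)]].

Definition polytabloid (K : fieldType) (mu : seq nat) (r : nat)
    (F : filling mu r) : {ffun tabloid mu r -> K^o} :=
  \sum_(s in col_stab F)
     (-1) ^+ odd_perm s *: tabloid_vect K (tabloid_of (permute_filling s F)).

Definition specht_space (K : fieldType) (n : nat) (lam : partition_of n) :
  {vspace {ffun tabloid lam n -> K^o}} :=
  <<[seq polytabloid K F | F : filling lam n]>>%VS.

Definition specht (K : fieldType) (n : nat) (lam : partition_of n) :
  vectType K := subvs_of (specht_space K lam).

(* psi(t_k) b_T = b_(t_k T) (lemma psiE). The Kazhdan-Lusztig basis enters only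
   as a basis indexed by standard tableaux, so b is left arbitrary; this avoids
   fixing one of the competing normalisations of that basis. *)
Definition psi_fun (K : fieldType) (n : nat) (lam : partition_of n)
    (V : vectType K) (b : syt lam -> V) (k : nat) (v : V) : V :=
  \sum_(T : syt lam) coord (codom_tuple b) (enum_rank T) v *: b (t_syt k T).

Fact psi_fun_is_linear (K : fieldType) (n : nat) (lam : partition_of n)
    (V : vectType K) (b : syt lam -> V) (k : nat) : linear (psi_fun b k).
Proof.
move=> a u v; rewrite /psi_fun scaler_sumr -big_split; apply: eq_bigr => T _.
by rewrite linearP scalerDl scalerA.
Qed.
HB.instance Definition _ (K : fieldType) (n : nat) (lam : partition_of n)
    (V : vectType K) (b : syt lam -> V) (k : nat) :=
  GRing.isLinear.Build K V V *:%R (psi_fun b k) (psi_fun_is_linear b k).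

Definition psi (K : fieldType) (n : nat) (lam : partition_of n)
    (V : vectType K) (b : syt lam -> V) (k : nat) : 'End(V) :=
  linfun (psi_fun b k).

Lemma psiE (K : fieldType) (n : nat) (lam : partition_of n)
    (V : vectType K) (b : syt lam -> V) (k : nat) (T : syt lam) :
  basis_of fullv (codom b) -> psi b k (b T) = b (t_syt k T).
Proof.
move=> /basis_free bfree; rewrite lfunE /= /psi_fun (bigD1 T) //=.
have bE S : b S = (codom_tuple b)`_(enum_rank S).
  by rewrite /= /codom /image_mem (nth_map S) ?nth_enum_rank // -cardE.
rewrite {1}bE coord_free // eqxx scale1r big1 ?addr0 // => S neqST.
by rewrite bE coord_free // (inj_eq enum_rank_inj) eq_sym (negbTE neqST) scale0r.
Qed.

(* Main.v *)
(* The map sending [b T] to the indicator of the set of g in S_(n-1) that carry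
   {1, ..., a} onto the (shifted) arm entries of T is the isomorphism. A hook
   tableau is determined by its arm entries, and every a-subset of {2, ..., n}
   occurs, so these indicators form a basis of the induced module. Equivariance
   under simple transpositions: k + 1 and k + 2 are adjacent exactly when both
   lie in the arm or both in the leg, and then s_k fixes the arm set. *)

Require Import Defs.
From mathcomp Require Import all_boot all_order all_algebra all_fingroup.
From mathcomp Require Import reals complex.
From mathcomp Require Import zify.

Set Implicit Arguments.
Unset Strict Implicit.
Unset Printing Implicit Defensive.

Import GRing.Theory GroupScope.
Local Open Scope ring_scope.

(* Defs.row and Defs.col are shadowed by the row and column of a matrix. *)
Local Notation row := Defs.row.
Local Notation col := Defs.col.

(** * Simple transpositions and generation of the symmetric group *)

Lemma simple_transpE (r k : nat) (i : 'I_r) : (0 < k < r)%N ->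
  simple_transp r k i =
    (if i == k.-1 :> nat then k else if i == k :> nat then k.-1 else i) :> nat.
Proof.
move=> hk; rewrite /simple_transp.
case: insubP => [x _ /= xE|]; last by lia.
case: insubP => [y _ /= yE|]; last by lia.
case: tpermP => [->|->|/eqP nix /eqP niy].
- by rewrite xE yE eqxx.
- by rewrite xE yE eqxx; case: eqP; lia.
- by move: nix niy; rewrite -!val_eqE /= xE yE => /negbTE-> /negbTE->.
Qed.

Lemma simple_transpK (r k : nat) : (simple_transp r k * simple_transp r k = 1)%g.
Proof.
rewrite /simple_transp; case: insubP => [x _ _|_]; last by rewrite mulg1.
by case: insubP => [y _ _|_]; rewrite ?mulg1 ?tperm2.
Qed.

(** The transpositions moving [ord0] generate the group. Conjugating the one that swaps 0 and y by
    the simple transposition of y and y + 1 gives the one that swaps 0 and y + 1, so all are reached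
    by induction on y. *)
Lemma simple_transp_gen (r : nat) :
  <<[set simple_transp r k | k : 'I_r & (0 < k)%N]>>%g = [set: 'S_r].
Proof.
case: r => [|r].
  apply/setP=> g; rewrite inE (_ : g = 1%g) ?group1 //.
  by apply/permP=> -[].
apply/eqP; rewrite eqEsubset subsetT -(gen_tperm ord0) gen_subG.
apply/subsetP=> _ /imsetP[[y hy] _ ->]; elim: y hy => [|y IH] hy.
  by rewrite (_ : Ordinal hy = ord0) ?tperm1 ?group1 //; apply: val_inj.
have hy' : (y < r.+1)%N by lia.
have gy : simple_transp r.+1 y.+1 \in
    <<[set simple_transp r.+1 k | k : 'I_r.+1 & (0 < k)%N]>>%g.
  by apply/mem_gen/imsetP; exists (Ordinal hy); rewrite ?inE.
(* For y = 0 conjugation would move 0, but the generator is already the wanted transposition. *)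
have [y0|ypos] := posnP y.
  move: gy; rewrite /simple_transp; case: insubP => [u _ /= uE|/=]; last by lia.
  case: insubP => [v _ /= vE|/=]; last by lia.
  by rewrite (_ : u = ord0) 1?(_ : v = Ordinal hy) //; apply: val_inj => /=; lia.
have := groupJ (IH hy') gy; rewrite tpermJ.
rewrite (_ : simple_transp _ _ ord0 = ord0); last first.
  by apply: val_inj; rewrite /= simple_transpE; first do ![case: eqP => /=]; lia.
rewrite (_ : simple_transp _ _ (Ordinal hy') = Ordinal hy) //.
by apply: val_inj; rewrite /= simple_transpE /=; first do ![case: eqP => /=]; lia.
Qed.

(** In a finite group every element is a product of generators without inverses, so right
    multiplication by generators reaches everything from 1. *)
Lemma simple_transp_ind (r : nat) (P : 'S_r -> Prop) :
  P 1%g ->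
  (forall g k, (0 < k < r)%N -> P g -> P (g * simple_transp r k)%g) ->
  forall g, P g.
Proof.
move=> P1 PM g.
have /gen_prodgP[m [c cE ->]] :
    g \in <<[set simple_transp r k | k : 'I_r & (0 < k)%N]>>%g.
  by rewrite simple_transp_gen inE.
elim: m c cE => [|m IH] c cE; first by rewrite big_ord0.
rewrite big_ord_recr /=; have /imsetP[k] := cE ord_max.
by rewrite inE => kpos ->; apply: PM; [rewrite kpos ltn_ord | apply: IH].
Qed.

(** * Fillings, boxes and the two blocks *)

Lemma filling_inj (mu : seq nat) (r : nat) (F : filling mu r) :
  injective (box_entry F).
Proof. by have /andP[/injectiveP] := valP F. Qed.

Lemma filling_surj (mu : seq nat) (r : nat) (F : filling mu r) (k : 'I_r) :
  exists x, box_entry F x = k.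
Proof.
have /andP[_ /forallP/(_ k)/codomP[x kE]] := valP F.
by exists x.
Qed.

Lemma box_inj (mu : seq nat) (x y : box mu) :
  row x = row y -> col x = col y -> x = y.
Proof.
rewrite /row /col; case: x y => [i u] [j v] /= /val_inj ij.
by case: _ / ij v => v /val_inj ->.
Qed.

Lemma box_exists (mu : seq nat) (r c : nat) :
  (r < size mu)%N -> (c < nth 0%N mu r)%N ->
  exists x : box mu, row x = r /\ col x = c.
Proof.
move=> hr hc.
by exists (Tagged (fun i : 'I_(size mu) => 'I_(nth 0%N mu i))
             (Ordinal hc : 'I_(nth 0%N mu (Ordinal hr)))).
Qed.

Lemma reshape_index2 (p q i : nat) : (i < p + q)%N ->
  reshape_index [:: p; q] i = (p <= i)%N.
Proof.
move=> hi; rewrite /reshape_index /=.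
by do 2?[case: ifP => [/eqP ?|/eqP ?]]; lia.
Qed.

(* Shifting entries by one, [g] sends the first block of [arm, leg] onto the set
   of arm entries of [F]. *)
Definition arm_on (n : nat) (lam : seq nat) (F : filling lam n)
    (g : 'S_(n.-1)) : bool :=
  [forall i, forall x, (box_entry F x == (g i).+1 :> nat) ==>
     ((row x == 0%N) == (i < arm lam)%N)].

Lemma arm_onP (n : nat) (lam : seq nat) (F : filling lam n) (g : 'S_(n.-1)) :
  reflect (forall i x, box_entry F x = (g i).+1 :> nat ->
             (row x == 0%N) = (i < arm lam)%N) (arm_on F g).
Proof.
apply: (iffP forallP) => [H i x /eqP e | H i].
  by have /forallP/(_ x)/implyP/(_ e)/eqP := H i.
by apply/forallP=> x; apply/implyP=> /eqP/H->.
Qed.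

(** * Bases indexed by a finite type *)

Lemma lfun_of_basis (K : fieldType) (V W : vectType K) (I : finType)
    (b : I -> V) (d : I -> W) :
  basis_of fullv (codom b) -> exists f : 'Hom(V, W), forall i, f (b i) = d i.
Proof.
move=> /basis_free bfree.
have [f fE] := linear_of_free (codom b) (codom d).
have /eq_in_map fd : map (f \o b) (enum I) = map d (enum I).
  by rewrite map_comp; apply: fE => //; rewrite !size_codom.
by exists (linfun f) => i; rewrite lfunE /=; apply: fd; rewrite mem_enum.
Qed.

Lemma basis_codom_sum (K : fieldType) (V : vectType K) (I : finType)
    (b : I -> V) (v : V) :
  basis_of fullv (codom b) -> exists c : I -> K, v = \sum_i c i *: b i.
Proof.
move=> hb; exists (fun i => coord (codom_tuple b) (enum_rank i) v).
rewrite [LHS](@coord_basis _ _ _ _ (codom_tuple b) _ hb (memvf v)).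
rewrite (reindex (@enum_rank I)) /=; last by apply: onW_bij; exact: enum_rank_bij.
apply: eq_bigr => i _; congr (_ *: _).
by rewrite /codom /image_mem (nth_map i) ?nth_enum_rank // -cardE.
Qed.

(** * Standard tableaux of hook shape *)

Section Hook.

Variables (n a l : nat) (lam : partition_of n).
Hypothesis lamE : lam = a.+1 :: nseq l 1%N :> seq nat.

Lemma hook_size : n = (a + l).+1.
Proof.
by have /and3P[_ _ /eqP] := partsP lam; rewrite lamE /= sumn_nseq; lia.
Qed.

Lemma hook_arm : arm lam = a. Proof. by rewrite lamE. Qed.

Lemma hook_leg : leg lam = l. Proof. by rewrite lamE /leg /= size_nseq. Qed.

Lemma hook_boxP (x : box lam) :
  (row x = 0%N /\ (col x <= a)%N) \/ ((0 < row x <= l)%N /\ col x = 0%N).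
Proof.
have hr : (row x < (size lam))%N := ltn_ord (tag x).
have : (col x < nth 0%N lam (row x))%N := ltn_ord (tagged x).
move: (row x) (col x) hr => r c; rewrite lamE /= size_nseq.
case: r => [|r] /=; first by left; lia.
by rewrite ltnS => hr; rewrite nth_nseq hr; right; lia.
Qed.

Lemma hook_arm_box (c : nat) : (c <= a)%N ->
  exists x : box lam, row x = 0%N /\ col x = c.
Proof. by move=> hc; apply: box_exists; rewrite lamE. Qed.

Lemma hook_leg_box (r : nat) : (0 < r <= l)%N ->
  exists x : box lam, row x = r /\ col x = 0%N.
Proof.
case: r => // r hr; apply: box_exists; rewrite lamE /= ?size_nseq //.
by rewrite nth_nseq; case: ifP; lia.
Qed.

Lemma standard_lt (F : filling lam n) (x y : box lam) : standard F ->
  (row x == row y) && (col x < col y)%N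
    || (col x == col y) && (row x < row y)%N ->
  (box_entry F x < box_entry F y)%N.
Proof. by move=> /forallP/(_ x)/forallP/(_ y)/implyP. Qed.

Lemma standard_corner (F : filling lam n) (x : box lam) : standard F ->
  box_entry F x = 0%N :> nat -> row x = 0%N /\ col x = 0%N.
Proof.
move=> stdF Fx0; have [z [rz cz]] := hook_arm_box (leq0n a).
have := @standard_lt F z x stdF; rewrite Fx0 rz cz.
by case: (hook_boxP x) => -[]; lia.
Qed.

(** Positive entries avoid the corner, and once the corner is removed no box of the arm is adjacent
    to a box of the leg. *)
Lemma adjacent_hook (F : filling lam n) (x y : box lam) : standard F ->
  adjacent x y -> (0 < box_entry F x)%N -> (0 < box_entry F y)%N ->
  (row x == 0%N) = (row y == 0%N).
Proof.
move=> stdF xy; have [z [rz cz]] := hook_arm_box (leq0n a).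
have corner w : (0 < box_entry F w)%N -> ~ (row w = 0%N /\ col w = 0%N).
  move=> wpos [rw cw]; have ezw : z = w by apply: box_inj; lia.
  have hn0 : (0 < n)%N by rewrite hook_size.
  have [w' /(congr1 val)/= w'0] := filling_surj F (Ordinal hn0).
  have [rw' cw'] := @standard_corner F w' stdF w'0.
  have e : w' = w by apply: box_inj; lia.
  by move: w'0; rewrite e; lia.
move=> /corner nx /corner ny; move: xy; rewrite /adjacent.
by case: (hook_boxP x) (hook_boxP y) => -[? ?] [] [? ?]; lia.
Qed.

(** * Arm sets of standard tableaux *)

(** The shift by one turns the swap of k and k + 1 among values of [g] into the swap of k + 1 and k
    + 2 among entries, hence the index [k.+1]. If these entries are adjacent, [F] stays put, but its
    arm contains both or neither. *)
Lemma arm_on_step (k : nat) (F : filling lam n) (g : 'S_(n.-1)) :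
  standard F -> (0 < k < n.-1)%N ->
  arm_on (t_filling k.+1 F) (g * simple_transp n.-1 k)%g = arm_on F g.
Proof.
move=> stdF hk; rewrite /t_filling; case: ifPn => [/existsP[x /existsP[y]] | _].
  case/and3P => /eqP xk /eqP yk xy.
  have rxy : (row x == 0%N) = (row y == 0%N) by apply: (@adjacent_hook F) => //; lia.
  (* One implication suffices, because the simple transposition is an involution. *)
  have imp h : arm_on F h -> arm_on F (h * simple_transp n.-1 k)%g.
    move=> /arm_onP H; apply/arm_onP => i z; rewrite permM simple_transpE //.
    case: eqP => [e1|n1] => [Fz|].
      have -> : z = y by apply/(@filling_inj _ _ F)/val_inj => /=; lia.
      by rewrite -rxy; apply: H; lia.
    case: eqP => [e2|n2] => [Fz|]; last exact: H.
    have -> : z = x by apply/(@filling_inj _ _ F)/val_inj => /=; lia.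
    by rewrite rxy; apply: H; lia.
  apply/idP/idP => [/imp|]; last exact: imp.
  by rewrite -mulgA simple_transpK mulg1.
apply: eq_forallb => i; apply: eq_forallb => x; congr (_ ==> _).
rewrite permute_fillingE permM !simple_transpE //; last by lia.
by apply/eqP/eqP; do ![case: eqP => //=]; lia.
Qed.

(** Through [g], each entry lies in the first row of both tableaux or of neither; the increasing
    order along arm and leg then fixes its box. *)
Lemma arm_on_eq (F G : filling lam n) (g : 'S_(n.-1)) :
  standard F -> standard G -> arm_on F g -> arm_on G g -> F = G.
Proof.
move=> stdF stdG /arm_onP Fg /arm_onP Gg.
have row0 x y : box_entry F x = box_entry G y -> (row x == 0%N) = (row y == 0%N).
  (* The entry 0 is not of the form [(g i).+1]; it sits in the corner of both tableaux. *)
  move=> Fxy; have [Fx0|Fxpos] := posnP (box_entry F x).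
    have [-> _] := standard_corner stdF Fx0.
    by have [-> _] := standard_corner stdG (etrans (congr1 val (esym Fxy)) Fx0).
  have hi : ((box_entry F x).-1 < n.-1)%N by have := ltn_ord (box_entry F x); lia.
  pose i := (g^-1)%g (Ordinal hi).
  have gi : (g i).+1 = box_entry F x :> nat by rewrite permKV /=; lia.
  by rewrite (Fg i x) // (Gg i y) // gi Fxy.
(* At the least entry k in different boxes of F and G, the two boxes are
   comparable, and the smaller one holds in the other tableau an entry below k. *)
suff FG k x y : box_entry F x = k :> nat -> box_entry G y = k :> nat -> x = y.
  apply/val_inj/ffunP => x; have [y Gy] := filling_surj G (box_entry F x).
  have e := FG _ _ _ erefl (congr1 val Gy).
  by rewrite -[RHS]/(box_entry G x) {2}e Gy.
elim/ltn_ind: k x y => k IH x y Fx Gy.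
have rxy : (row x == 0%N) = (row y == 0%N).
  by apply: row0; apply: val_inj; rewrite /= Fx Gy.
pose lt_box (u v : box lam) := (row u == row v) && (col u < col v)%N
    || (col u == col v) && (row u < row v)%N.
have : lt_box x y \/ lt_box y x \/ (row x = row y /\ col x = col y).
  rewrite /lt_box.
  by case: (hook_boxP x) (hook_boxP y) => -[? ?] [] [? ?]; lia.
case=> [/(standard_lt stdG) | [/(standard_lt stdF) | [rE cE]]].
- rewrite Gy => ltk; have [z Fz] := filling_surj F (box_entry G x).
  have zx := IH _ ltk z x (congr1 val Fz) erefl.
  by move: ltk; rewrite -Fz zx; lia.
- rewrite Fx => ltk; have [z Gz] := filling_surj G (box_entry F y).
  have yz := IH _ ltk y z erefl (congr1 val Gz).
  by move: ltk; rewrite -Gz -yz; lia.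
- exact: box_inj.
Qed.

(** This tableau is the base point: its shifted arm set is the first block, so it matches the
    identity permutation. *)
Lemma row_superstandard :
  exists T : syt lam, forall x, box_entry (val T) x =
    (if row x == 0%N then col x else (a + row x)%N) :> nat.
Proof.
have nE := hook_size.
have /fin_all_exists[f fE] : forall x : box lam, exists k : 'I_n,
    k = (if row x == 0%N then col x else (a + row x)%N) :> nat.
  move=> x.
  have hx : ((if row x == 0%N then col x else (a + row x)%N) < n)%N.
    by case: (hook_boxP x) => -[]; case: eqP; lia.
  by exists (Ordinal hx).
have bijf : @bijective_filling lam n [ffun x => f x].
  apply/andP; split.
    apply/injectiveP => x y; rewrite !ffunE => /(congr1 val) /=; rewrite !fE.
    move=> e; apply: box_inj; move: e;
    by case: (hook_boxP x) (hook_boxP y) => -[? ?] [] [? ?]; do ![case: eqP]; lia.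
  apply/forallP => k; apply/codomP.
  have := ltn_ord k; have [ka|ak] := leqP k a => kn.
    have [x [rx cx]] := hook_arm_box ka; exists x; rewrite ffunE.
    by apply: val_inj; rewrite /= fE rx eqxx.
  have [|x [rx cx]] := @hook_leg_box (k - a); first by lia.
  by exists x; rewrite ffunE; apply: val_inj; rewrite /= fE rx; case: eqP; lia.
pose F : filling lam n := Sub [ffun x => f x] bijf.
have FE x : box_entry F x = f x by rewrite /box_entry /= ffunE.
have stdF : standard F.
  apply/forallP => x; apply/forallP => y; apply/implyP; rewrite !FE !fE.
  by case: (hook_boxP x) (hook_boxP y) => -[? ?] [] [? ?]; do ![case: eqP]; lia.
by exists (Sub F stdF : syt lam) => x; rewrite /= FE.
Qed.

(** The operators [t_syt] preserve standardness and follow right multiplication of [g] by simple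
    transpositions, starting from the base tableau at 1. *)
Lemma arm_on_syt_exists (g : 'S_(n.-1)) : exists T : syt lam, arm_on (val T) g.
Proof.
have nE := hook_size.
elim/simple_transp_ind: g => [|g k hk [T Tg]]; last first.
  by exists (t_syt k.+1 T); rewrite arm_on_step //; exact: valP T.
have [T TE] := row_superstandard; exists T; apply/arm_onP => i x.
rewrite TE perm1 hook_arm.
by case: (hook_boxP x) => -[? ?]; case: eqP; lia.
Qed.

(** The permutation sends each nonzero entry of the base tableau to the entry of [T] in the same
    box, both shifted down by one; the corner holds 0 in both. *)
Lemma arm_on_perm_exists (T : syt lam) : exists g, arm_on (val T) g.
Proof.
have nE := hook_size.
have [T0 T0E] := row_superstandard.
have /fin_all_exists[f fE] : forall i : 'I_n.-1, exists j : 'I_n.-1, exists x,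
    box_entry (val T0) x = i.+1 :> nat /\ box_entry (val T) x = j.+1 :> nat.
  move=> i; have hi : (i.+1 < n)%N by have := ltn_ord i; lia.
  have [x /(congr1 val)/= xE] := filling_surj (val T0) (Ordinal hi).
  have Tx0 : (0 < box_entry (val T) x)%N.
    case: posnP => // /(standard_corner (valP T)) [rx cx].
    by move: xE; rewrite T0E rx cx.
  have hj : ((box_entry (val T) x).-1 < n.-1)%N.
    by have := ltn_ord (box_entry (val T) x); lia.
  by exists (Ordinal hj), x; rewrite xE prednK.
have finj : injective f.
  move=> i j fij; have [x [xi xf]] := fE i; have [y [yj yf]] := fE j.
  apply: val_inj => /=.
  have e : x = y by apply/(@filling_inj _ _ (val T))/val_inj; rewrite /= xf yf fij.
  by move: xi; rewrite e; lia.
exists (perm finj); apply/arm_onP => i x; rewrite permE hook_arm.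
have [y [yi yf]] := fE i => xf.
have -> : x = y by apply/(@filling_inj _ _ (val T))/val_inj; rewrite /= xf yf.
by move: yi; rewrite T0E; case: (hook_boxP y) => -[? ?]; case: eqP; lia.
Qed.

(** * Cosets of the Young subgroup and their indicators *)

Lemma youngP (h : 'S_(n.-1)) :
  reflect (forall i, (h i < a)%N = (i < a)%N)
          (h \in young_group n.-1 [:: arm lam; leg lam]).
Proof.
have nE := hook_size.
rewrite inE hook_arm hook_leg; apply: (iffP forallP) => H i; have := H i;
  rewrite !reshape_index2; have := ltn_ord i; have := ltn_ord (h i); lia.
Qed.

Lemma arm_on_young (F : filling lam n) (g h : 'S_(n.-1)) :
  h \in young_group n.-1 [:: arm lam; leg lam] ->
  arm_on F (h * g)%g = arm_on F g.
Proof.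
have imp h' g' : h' \in young_group n.-1 [:: arm lam; leg lam] ->
    arm_on F g' -> arm_on F (h' * g')%g.
  move=> /youngP h'Y /arm_onP H; apply/arm_onP => i x; rewrite permM => /H ->.
  by rewrite hook_arm h'Y.
move=> hY; apply/idP/idP; last exact: imp.
by move/(imp _ _ (groupVr hY)); rewrite mulKg.
Qed.

(** Together with [arm_on_young], this makes the permutations matching [F], if there are any, a
    single coset of the Young subgroup. *)
Lemma arm_on_coset (F : filling lam n) (g g' : 'S_(n.-1)) :
  arm_on F g -> arm_on F g' ->
  (g * g'^-1)%g \in young_group n.-1 [:: arm lam; leg lam].
Proof.
have nE := hook_size.
move=> /arm_onP Fg /arm_onP Fg'; apply/youngP => i; rewrite permM.
have hi : ((g i).+1 < n)%N by have := ltn_ord (g i); lia.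
have [x /(congr1 val)/= xE] := filling_surj F (Ordinal hi).
have := Fg i x xE; rewrite hook_arm => <-.
by rewrite (Fg' ((g'^-1)%g (g i)) x) ?permKV ?hook_arm.
Qed.

(** In the function model of the induced module, this is the basis vector of the tabloid whose first
    row is the shifted arm of [T]. *)
Definition arm_indicator (K : fieldType) (T : syt lam) :
  {ffun 'S_(n.-1) -> K^o} := [ffun g => (arm_on (val T) g)%:R].

Lemma arm_indicator_ind (K : fieldType) (T : syt lam) :
  arm_indicator K T
    \in ind_space (srepr_triv K (young_group n.-1 [:: arm lam; leg lam])).
Proof.
by apply/ind_spaceP => g h hY; rewrite /= id_lfunE !ffunE arm_on_young.
Qed.

(** * The isomorphism with the permutation module *)

Lemma hook_srepr_iso (K : fieldType) (V : vectType K) (b : syt lam -> V)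
    (eta : srepr [set: 'S_(n.-1)]%G V) :
  basis_of fullv (codom b) ->
  (forall k, (0 < k < n.-1)%N -> eta (simple_transp n.-1 k) = psi b k.+1) ->
  srepr_iso eta (perm_module K n.-1 [:: arm lam; leg lam]).
Proof.
move=> hb heta.
have [f fE] := lfun_of_basis (fun T => Subvs (arm_indicator_ind K T)) hb.
have fsumE c g : val (f (\sum_T c T *: b T)) g =
    \sum_T c T * (arm_on (val T) g)%:R.
  rewrite linear_sum /= linear_sum /= sum_ffunE; apply: eq_bigr => T _.
  by rewrite linearZ /= fE /= !ffunE.
(* By [arm_on_eq] no other tableau matches [g], so evaluation at [g] isolates one coefficient. *)
have fsum1 c g T : arm_on (val T) g -> val (f (\sum_T c T *: b T)) g = c T.
  move=> Tg; rewrite fsumE (bigD1 T) //= Tg mulr1 big1 ?addr0 // => S neqST.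
  case: (boolP (arm_on _ _)) => [Sg|]; last by rewrite mulr0.
  by case/eqP: neqST; apply/val_inj/(arm_on_eq (valP S) (valP T) Sg Tg).
exists f; split.
- apply/eqP; rewrite -subv0; apply/subvP => v; rewrite memv_ker memv0.
  have [c ->] := basis_codom_sum v hb => /eqP fv0.
  rewrite big1 // => T _; have [g Tg] := arm_on_perm_exists T.
  by rewrite -(fsum1 c g T Tg) fv0 ffunE scale0r.
- apply/eqP; rewrite eqEsubv subvf; apply/subvP => u _; apply/memv_imgP.
  have /fin_all_exists[h hE] := arm_on_perm_exists.
  (* An element of the induced module is constant on the coset attached to [T], so its value at the
     representative [h T] serves as coefficient. *)
  exists (\sum_T val u (h T) *: b T); first exact: memvf.
  apply/val_inj/ffunP => g; have [T Tg] := arm_on_syt_exists g.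
  rewrite (fsum1 _ _ _ Tg) -[g](mulgKV (h T)).
  have /ind_spaceP-> := subvsP u; first by rewrite /= id_lfunE.
  exact: arm_on_coset Tg (hE T).
- move=> g _; elim/simple_transp_ind: g => [|g k hk IH] v.
    by rewrite !srepr1 !id_lfunE.
  (* The last factor acts last, so after the induction hypothesis it acts on an arbitrary vector,
     and basis vectors suffice. *)
  rewrite !sreprM ?inE // !comp_lfunE -IH; move: (eta g v) => {}v.
  rewrite heta // -!comp_lfunE; move: v; apply/lfunP.
  apply/(fullv_lfunP _ _ (span_basis hb)) => _ /codomP[T ->].
  rewrite !comp_lfunE psiE // !fE lfunE; apply/val_inj/ffunP => x /=.
  (* The induced action evaluates at [x] times the inverse transposition; splitting [x] accordingly
     brings the left side to the form of [arm_on_step]. *)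
  rewrite !ffunE -[in LHS](mulgKV (simple_transp n.-1 k) x).
  by rewrite arm_on_step //; exact: valP T.
Qed.

End Hook.

Unset Implicit Arguments.

Theorem proposition3p19 (R : realType) (n : nat) (hn : (2 <= n)%N)
    (lam : partition_of n) (hhook : is_hook lam)
    (b : syt lam -> specht R[i] lam)
    (hb : basis_of fullv (codom b))
    (eta : srepr [set: 'S_(n.-1)]%G (specht R[i] lam))
    (heta : forall k : nat, (1 <= k <= n - 2)%N ->
       eta (simple_transp n.-1 k) = psi b k.+1) :
  srepr_iso eta (perm_module R[i] n.-1 [:: arm lam; leg lam]).
Proof.
(* A hook with first part 0 is excluded, since a partition has no zero part. *)
have [[|a] [l lamE]] := hhook.
  by have /and3P[_] := partsP lam; rewrite lamE inE.
by apply: (hook_srepr_iso lamE hb) => k hk; apply: heta; lia.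
Qed.
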